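(* For every integer $n\geq 1$, the number of spanning quasi-trees of the bouquet $\mathbb{F}^{1}_n$ is the $(n+2)$-th Fibonacci number: $\kappa(\mathbb{F}^{1}_n)=f_{n+2}$.
   Context: A bouquet is a ribbon graph (surface with boundary made of vertex discs and edge ribbons) with exactly one vertex. A quasi-tree is a ribbon graph with exactly one boundary component; $\kappa(G)$ is the number of $F\subseteq E(G)$ such that the spanning ribbon subgraph $(V(G),F)$ (delete edges outside $F$) is a quasi-tree. A bouquet with edges $1,\dots,n$ is given by a signed rotation: a cyclic sequence in which each label occurs twice, recording the order in which the edge ends meet the vertex boundary; occurrences may carry a minus sign (plus omitted), and edge $i$ is an orientable loop iff its two occurrences have the same sign, non-orientable (forming a Möbius band with the vertex) otherwise. $\mathbb{F}_n$ has signed rotation $1$, followed by $i,i-1$ for $i=2,\dots,n$, followed by $n$, i.e. $(1,2,1,3,2,4,3,\dots,n,n-1,n)$ (so $\mathbb{F}_1=(1,1)$). $\mathbb{F}^{1}_n$ is obtained by adding a half-twist to edge $1$: signed rotation $(-1,2,1,3,2,\dots,n,n-1,n)$, with $\mathbb{F}^1_1=(-1,1)$. Fibonacci numbers: $f_1=f_2=1$, $f_k=f_{k-1}+f_{k-2}$. *)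

(* Defs.v *)
From mathcomp Require Import all_boot finmap.

Set Implicit Arguments.
Unset Strict Implicit.
Unset Printing Implicit Defensive.

(* The letter (i, b) is an end of the edge i; b = true iff it carries a minus
   sign.  A cyclic sequence is represented by any of its linear readings. *)
Definition letter : Type := (nat * bool)%type.

Definition is_signed_rotation (s : seq letter) : bool :=
  all (fun i => count_mem i (unzip1 s) == 2) (unzip1 s).

Record bouquet := Bouquet {
  rotation :> seq letter;
  rotationP : is_signed_rotation rotation
}.

Definition edges (B : bouquet) : {fset nat} := [fset i in unzip1 (rotation B)]%fset.

Lemma restrict_rotationP (B : bouquet) (F : {fset nat}) :
  is_signed_rotation [seq x <- rotation B | x.1 \in F].
Proof.
rewrite /is_signed_rotation.
have -> : unzip1 [seq x <- rotation B | x.1 \in F] =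
          [seq i <- unzip1 (rotation B) | i \in F].
  by rewrite /unzip1 filter_map.
apply/allP => i; rewrite mem_filter => /andP[iF iB].
rewrite count_filter; apply/eqP.
rewrite -[RHS](eqP (allP (rotationP B) i iB)); apply: eq_count => j /=.
by case: eqP => // ->; rewrite iF.
Qed.

Definition spanning_subgraph (B : bouquet) (F : {fset nat}) : bouquet :=
  Bouquet (restrict_rotationP B F).

Section Boundary.
Variable s : seq letter.

(* An edge end p meets the vertex boundary in a segment with two endpoints:
   (p, false) where it starts and (p, true) where it stops, when travelling
   along the vertex boundary in the direction of the rotation. *)
Definition corner : finType := ('I_(size s) * bool)%type.

Definition end_at (p : 'I_(size s)) : letter := tnth (in_tuple s) p.

(* The arc of the vertex boundary from one edge end to the next one. *)
Definition vertex_arc (c d : corner) : bool :=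
  [&& c.2, ~~ d.2 & d.1 == ordS c.1].

(* The two free sides of a ribbon: an untwisted ribbon joins the start of each
   of its ends to the stop of the other one; a half-twisted ribbon joins start
   to start and stop to stop. *)
Definition ribbon_side (c d : corner) : bool :=
  let x := end_at c.1 in let y := end_at d.1 in
  [&& c.1 != d.1, x.1 == y.1 & (c.2 != d.2) == (x.2 == y.2)].

Definition boundary_adj : rel corner :=
  fun c d => [|| vertex_arc c d, vertex_arc d c | ribbon_side c d].

Lemma boundary_adj_sym : symmetric boundary_adj.
Proof.
move=> c d; rewrite /boundary_adj /ribbon_side orbCA.
by rewrite (eq_sym d.1) (eq_sym (end_at d.1).1) (eq_sym d.2)
           (eq_sym (end_at d.1).2).
Qed.

(* The boundary of the surface is the union of the vertex arcs and the ribbon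
   sides, except that with no edge it is the circle bounding the vertex disc,
   which carries no corner. *)
Definition n_boundary : nat :=
  n_comp boundary_adj [set: corner] + (size s == 0).

End Boundary.

Definition quasi_tree (B : bouquet) : bool := n_boundary (rotation B) == 1.

Definition kappa (B : bouquet) : nat :=
  #|` [fset F in fpowerset (edges B) | quasi_tree (spanning_subgraph B F)]%fset |%fset.

Definition F_word (n : nat) : seq nat :=
  1 :: flatten [seq [:: i; i.-1] | i <- iota 2 n.-1] ++ [:: n].

Lemma F_word_perm (n : nat) :
  0 < n -> perm_eq (F_word n) (iota 1 n ++ iota 1 n).
Proof.
case: n => // m _; rewrite /F_word /=.
have H k : perm_eq (flatten [seq [:: i; i.-1] | i <- iota 2 k])
                   (iota 2 k ++ iota 1 k).
  elim: k => // k IHk; rewrite -[k.+1]addn1 !iotaD map_cat flatten_cat /=.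
  apply/permP => a; move/permP: IHk => /(_ a).
  by rewrite !count_cat /= !addn0 => ->; rewrite addnACA add1n.
apply/permP => a; move/permP: (H m) => /(_ a).
rewrite /= !count_cat /= !addn0 => ->.
rewrite !addnA.
have E : a 1 + count a (iota 2 m) = count a (iota 1 m) + a m.+1.
  rewrite -[LHS]/(count a (iota 1 m.+1)) -[m.+1]addn1 iotaD count_cat /=.
  by rewrite addn0 add1n addn1.
by rewrite -[RHS]addnA E -addnA.
Qed.

Definition F1_rotation (n : nat) : seq letter :=
  if F_word n is i :: w then (i, true) :: [seq (j, false) | j <- w] else [::].

Lemma F1_rotationP (n : nat) : 0 < n -> is_signed_rotation (F1_rotation n).
Proof.
move=> n_gt0; rewrite /is_signed_rotation.
have -> : unzip1 (F1_rotation n) = F_word n.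
  by rewrite /F1_rotation /= /unzip1 -map_comp map_id.
have E := F_word_perm n_gt0; apply/allP => i.
rewrite (perm_mem E) mem_cat orbb => iI.
by rewrite (permP E) count_cat count_uniq_mem ?iota_uniq // iI.
Qed.

Definition bouquetF1 (n : nat) (n_gt0 : 0 < n) : bouquet :=
  Bouquet (F1_rotationP n_gt0).

Fixpoint fib (k : nat) : nat :=
  match k with
  | 0 => 0
  | 1 => 1
  | (k'.+1 as k1).+1 => fib k1 + fib k'
  end.

(* Main.v *)
Require Import Defs.
From mathcomp Require Import all_boot finmap.
From mathcomp Require Import zify.

(** The surface of a rotation has one boundary component iff every 2-colouring
    of the corners that is constant along vertex arcs and ribbon sides is
    constant.  Solving the colouring equations locally gives two facts: a word
    [W i i] with [i] new is never a quasi-tree, and a word [W a X b a b] with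
    [a], [b] new is a quasi-tree iff [W X] is.  Reading the rotation of the
    spanning subgraph on [F] from its last letter, they show that [F] is a
    quasi-tree iff every maximal run of consecutive edges of [F] not containing
    [1] has even length, and such sets satisfy the Fibonacci recursion. *)

Set Implicit Arguments.
Unset Strict Implicit.
Unset Printing Implicit Defensive.

(** * Colourings of the boundary *)

(* An edge end together with the colours of its start and stop corners. *)
Definition cletter : Type := (letter * (bool * bool))%type.

(** [c] and [d] are the colours of the vertex arcs entering and leaving the word; each inner arc
    forces the stop of one end and the start of the next to agree. *)
Fixpoint chain (c : bool) (t : seq cletter) (d : bool) : bool :=
  if t is u :: t' then (u.2.1 == c) && chain u.2.2 t' d else c == d.

Definition ribbon_colored (u v : cletter) : bool :=
  (u.1.1 == v.1.1) ==>
  if u.1.2 == v.1.2 then (u.2.1 == v.2.2) && (u.2.2 == v.2.1)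
  else (u.2.1 == v.2.1) && (u.2.2 == v.2.2).

Definition monochromatic (c : bool) (t : seq cletter) : bool :=
  all (fun u => u.2 == (c, c)) t.

(** Using [c] at both ends of the chain closes the word cyclically. The empty word qualifies
    trivially, matching the single boundary circle of a bare disc. *)
Definition colorings_constant (s : seq letter) : Prop :=
  forall (t : seq cletter) (c : bool), unzip1 t = s -> chain c t c ->
    pairwise ribbon_colored t -> monochromatic c t.

Lemma chain_cat c t1 t2 d :
  chain c (t1 ++ t2) d -> exists2 e, chain c t1 e & chain e t2 d.
Proof.
elim: t1 c => [|u t1 IH] c /= => [cd|]; first by exists c.
by case/andP=> -> /IH[e e1 e2]; exists e.
Qed.

Lemma cat_chain c t1 e t2 d :
  chain c t1 e -> chain e t2 d -> chain c (t1 ++ t2) d.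
Proof.
elim: t1 c => [|u t1 IH] c /=; first by move/eqP->.
by case/andP=> -> /IH.
Qed.

Lemma chain_monochromatic c t d : chain c t d -> monochromatic c t -> d = c.
Proof.
elim: t => [|u t IH] /=; first by move/eqP.
by case/andP=> _ ch /andP[/eqP uc]; apply: IH; move: ch; rewrite uc.
Qed.

Lemma cycle_chain t :
  cycle (fun u v : cletter => u.2.2 == v.2.1) t -> exists c, chain c t c.
Proof.
case: t => [|u t]; first by exists true.
rewrite /cycle => ut; exists u.2.1; rewrite /= eqxx /=.
elim: t {1 3}u ut => [|v t IH] w /=; first by rewrite andbT.
by case/andP=> /eqP <- /IH; rewrite eqxx.
Qed.

Lemma chain_cycle c t :
  chain c t c -> cycle (fun u v : cletter => u.2.2 == v.2.1) t.
Proof.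
case: t => [|u t] //; rewrite /cycle /= => /andP[/eqP <-].
elim: t {1 3}u => [|v t IH] w /=; first by move/eqP->; rewrite eqxx.
by case/andP=> /eqP -> /IH ->; rewrite eqxx.
Qed.

(** Turns cyclic adjacency into successor modulo the length, the form given by [ordS] in
    [vertex_arc]. *)
Lemma cycle_nthP (T : Type) (e : rel T) (x0 : T) (s : seq T) :
  reflect (forall i, i < size s -> e (nth x0 s i) (nth x0 s (i.+1 %% size s)))
          (cycle e s).
Proof.
case: s => [|x s]; first by apply: (iffP idP).
have nth1 i : i < (size s).+1 -> nth x0 (x :: rcons s x) i = nth x0 (x :: s) i.
  by rewrite -rcons_cons nth_rcons => ->.
have nth2 i : i < (size s).+1 ->
    nth x0 (rcons s x) i = nth x0 (x :: s) (i.+1 %% (size s).+1).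
  rewrite ltnS leq_eqVlt nth_rcons => /orP[/eqP ->|lti].
    by rewrite ltnn eqxx modnn.
  by rewrite lti modn_small.
rewrite /cycle; apply: (iffP (pathP x0)); rewrite size_rcons => H i lti.
  by rewrite -nth1 // -nth2 //; apply: H.
by rewrite nth1 // nth2 //; apply: H.
Qed.

(** [pairwise] tests two ends in reading order only, while [ribbon_side] relates them in both
    orders. *)
Lemma ribbon_colored_sym : symmetric ribbon_colored.
Proof.
move=> [[i a] [c d]] [[j b] [c' d']]; rewrite /ribbon_colored /= eq_sym.
by case: (j == i) => //; case: a b c d c' d' => [] [] [] [] [] [].
Qed.

Lemma n_comp1P (T : finType) (e : rel T) : connect_sym e ->
  reflect ((exists x : T, true) /\ forall x y, connect e x y)
          (n_comp e [set: T] == 1).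
Proof.
move=> sym_e; apply: (iffP idP).
- rewrite /n_comp_mem => /eqP/mem_card1[r Hr].
  have rE x : root e x = r.
    have := Hr (root e x); rewrite !inE roots_root // => /esym/eqP ->; exact.
  split=> [|x y]; first by exists r.
  by rewrite -(root_connect sym_e) !rE.
- case=> [[x _] Hc]; apply/eqP; rewrite /n_comp_mem.
  rewrite -(card1 (root e x)); apply: eq_card => y; rewrite !inE andbT.
  apply/idP/eqP => [/eqP <-|->]; last exact: roots_root.
  exact/(rootP sym_e).
Qed.

(** On connected corners a compatible colouring is constant; conversely, the indicator of a
    connected component is a compatible colouring. *)
Lemma n_boundary1P (s : seq letter) :
  n_boundary s == 1 <-> colorings_constant s.
Proof.
case: (posnP (size s)) => [/size0nil -> | s_gt0].
  split=> [_ [|//] //|_]; rewrite /n_boundary /= addn1 eqSS /n_comp_mem.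
  by rewrite eq_card0 // => -[[]].
have sym_s : connect_sym (@boundary_adj s).
  exact/sym_connect_sym/boundary_adj_sym.
rewrite /n_boundary eqn0Ngt s_gt0 addn0; split.
- case/(n_comp1P sym_s) => _ conn t c ts ch rib.
  set x0 : cletter := ((0, false), (false, false)).
  have szt : size t = size s by rewrite -ts size_map.
  pose f (x : corner s) := let u := (nth x0 t x.1).2 in if x.2 then u.2 else u.1.
  have endE p : @end_at s p = (nth x0 t p).1.
    rewrite /end_at (tnth_nth x0.1) /= -{1}ts (nth_map x0) // szt; exact: ltn_ord.
  have arc_f x y : vertex_arc x y -> f x = f y.
    case: x y => [p a] [q b]; rewrite /vertex_arc /f /= => /and3P[-> /negbTE -> /eqP ->].
    have := cycle_nthP _ x0 t (chain_cycle ch) p; rewrite szt => /(_ (ltn_ord p)).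
    by move/eqP.
  have rib_f x y : ribbon_side x y -> f x = f y.
    case: x y => [p a] [q b]; rewrite /ribbon_side /f /= !endE => /and3P[pq lab].
    have : ribbon_colored (nth x0 t p) (nth x0 t q).
      have pw := pairwiseP x0 rib.
      case: (ltngtP p q) => [ltpq|ltqp|epq].
      + by apply: pw; rewrite // inE szt.
      + by rewrite ribbon_colored_sym; apply: pw; rewrite // inE szt.
      + by rewrite (val_inj epq) eqxx in pq.
    rewrite /ribbon_colored lab /=.
    by case: ifP => _ /andP[/eqP e1 /eqP e2]; case: a b => [] [].
  have f_const x y : f x = f y.
    have cl : closed (@boundary_adj s) [pred z | f z == f x].
      move=> z w; rewrite !inE /boundary_adj.
      by case/or3P => [/arc_f ->|/arc_f ->|/rib_f ->].
    by have := closed_connect cl (conn x y); rewrite !inE eqxx => /esym/eqP ->.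
  (* The start corner of the first letter lies on the closing arc, whose colour is [c]. *)
  have fc x : f x = c.
    rewrite (f_const x (Ordinal s_gt0, false)) /f /=.
    by case: (t) szt s_gt0 ch => [<- //|u t' _ _ /= /andP[/eqP]].
  apply/(all_nthP x0) => i; rewrite szt => lti; apply/eqP.
  have := fc (Ordinal lti, false); have := fc (Ordinal lti, true).
  by rewrite /f /=; case: (nth x0 t i).2 => ? ? /= -> ->.
- move=> good; apply/(n_comp1P sym_s); split; first by exists (Ordinal s_gt0, true).
  move=> x y.
  (* Colour by membership in the component of [x]; [t] is the rotation so coloured. *)
  pose f := connect (@boundary_adj s) x.
  pose g p : cletter := (@end_at s p, (f (p, false), f (p, true))).
  pose t := [seq g p | p <- enum 'I_(size s)].
  have szt : size t = size s by rewrite size_map size_enum_ord.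
  set x0 : cletter := ((0, false), (false, false)).
  have nthE i (lti : i < size s) : nth x0 t i = g (Ordinal lti).
    rewrite (nth_map (Ordinal lti)) ?size_enum_ord //; congr g.
    by apply: val_inj; rewrite /= nth_enum_ord.
  have fE z w : boundary_adj z w -> f z = f w.
    by move=> zw; apply: (same_connect_r sym_s); apply: connect1.
  have ts : unzip1 t = s.
    apply: (@eq_from_nth _ x0.1); rewrite size_map // szt => i lti.
    by rewrite (nth_map x0) ?szt // nthE /= /end_at (tnth_nth x0.1).
  have [c ch] : exists c, chain c t c.
    apply/cycle_chain/(cycle_nthP _ x0) => i; rewrite szt => lti.
    have lti' : i.+1 %% size s < size s by rewrite ltn_pmod.
    rewrite !nthE /=; apply/eqP/fE; rewrite /boundary_adj /vertex_arc /=.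
    by apply/orP; left; apply/eqP/val_inj.
  have rib : pairwise ribbon_colored t.
    apply/(pairwiseP x0) => i j; rewrite !inE szt => lti ltj ltij.
    rewrite !nthE /ribbon_colored /=; apply/implyP => lab.
    have F a b : (a != b) == ((@end_at s (Ordinal lti)).2 == (@end_at s (Ordinal ltj)).2) ->
      f (Ordinal lti, a) = f (Ordinal ltj, b).
      move=> ab; apply: fE; rewrite /boundary_adj /ribbon_side /= lab ab /=.
      by rewrite -val_eqE /= neq_ltn ltij !orbT.
    by case: ifP => e; apply/andP; split; apply/eqP/F; rewrite e.
  have mono := good t c ts ch rib.
  have fc z : f z = c.
    case: z => p b.
    have := all_nthP x0 mono p; rewrite szt => /(_ (ltn_ord p)) /eqP.
    rewrite nthE /=; have -> : Ordinal (ltn_ord p) = p by apply: val_inj.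
    by case: b => -[].
  by rewrite -/(f y) fc -(fc x) /f connect0.
Qed.

(** * Local reductions of rotations *)

Lemma ribbon_colored_fresh (i : nat) (u v : cletter) :
  u.1.1 = i -> v.1.1 != i -> ribbon_colored v u.
Proof. by rewrite /ribbon_colored => -> /negbTE ->. Qed.

(** The arc between the adjacent ends of an untwisted edge closes up with one ribbon side into a
    separate boundary circle; colour it [true] and all else [false]. *)
Lemma colorings_constant_kink (W : seq letter) (x : letter) :
  x.1 \notin unzip1 W -> ~ colorings_constant (W ++ [:: x; x]).
Proof.
move=> xW good.
pose tW : seq cletter := [seq (y, (false, false)) | y <- W].
have chW : chain false tW false by rewrite /tW; elim: (W).
have := good (tW ++ [:: (x, (false, true)); (x, (true, false))]) false.
rewrite /monochromatic all_cat /= andbF => /(_ _ _ _)/notF; apply.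
- by rewrite /unzip1 map_cat /tW -map_comp map_id.
- exact: cat_chain chW _.
- rewrite pairwise_cat; apply/and3P; split; last by rewrite /= /ribbon_colored /= !eqxx.
  + apply/allrelP => u v /mapP[y yW ->] vx; apply: (@ribbon_colored_fresh x.1).
      by move: vx; rewrite !inE => /orP[] /eqP ->.
    by apply: contraNneq xW => <-; apply: map_f.
  + apply/(pairwiseP ((0, false), (false, false))) => i j.
    rewrite !inE size_map => iW jW _; rewrite !(nth_map (0, false)) //.
    by rewrite /ribbon_colored /= !eqxx !if_same implybT.
Qed.

Lemma map_eq_cat (T1 T2 : Type) (f : T1 -> T2) (t : seq T1) (s1 s2 : seq T2) :
  map f t = s1 ++ s2 ->
  exists t1 t2, [/\ t = t1 ++ t2, map f t1 = s1 & map f t2 = s2].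
Proof.
move=> tE; exists (take (size s1) t), (drop (size s1) t).
by rewrite cat_take_drop map_take map_drop tE take_size_cat // drop_size_cat.
Qed.

(** The two new edges are untwisted and interlaced, so their ribbon equations determine the colours
    of their ends from the arcs around [W]: colourings of the two words correspond. *)
Lemma colorings_constant_handle (W X : seq letter) (a b : letter) :
  a.1 != b.1 -> a.1 \notin unzip1 (W ++ X) -> b.1 \notin unzip1 (W ++ X) ->
  colorings_constant (W ++ a :: X ++ [:: b; a; b]) <-> colorings_constant (W ++ X).
Proof.
move=> neq_ab a_new b_new; split=> good t c.
- case/map_eq_cat=> tW [tX [-> tWE tXE]] /chain_cat[e chW chX] rib.
  have fresh z u : z.1 \notin unzip1 (W ++ X) -> u \in tW ++ tX -> u.1.1 != z.1.
    rewrite -tWE -tXE -map_cat => zn ut; apply: contraNneq zn => <-.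
    by rewrite /unzip1 map_f ?map_f.
  (* [e] colours the arc between [W] and [X], and [c] the closing arc; the new ends get the only
     colours their ribbons allow. *)
  pose t' := tW ++ (a, (e, e)) :: tX ++ [:: (b, (c, e)); (a, (e, e)); (b, (e, c))].
  have := good t' c; rewrite /t' /monochromatic !all_cat /= all_cat.
  move=> H; suff /and3P[-> _ /andP[-> _] //] : [&& all (fun u => u.2 == (c, c)) tW,
     (e, e) == (c, c) & all (fun u => u.2 == (c, c)) tX &&
     all (fun u => u.2 == (c, c)) [:: (b, (c, e)); (a, (e, e)); (b, (e, c))]].
  apply: H.
  + by rewrite /unzip1 map_cat /= map_cat tWE tXE.
  + by apply: cat_chain chW _; rewrite /= eqxx; apply: cat_chain chX _; rewrite /= !eqxx.
  + have newl z p u : z.1 \notin unzip1 (W ++ X) -> u \in tW ++ tX ->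
        ribbon_colored u (z, p).
      by move=> zn ut; apply: (@ribbon_colored_fresh z.1) => //; apply: fresh.
    have newr z p u : z.1 \notin unzip1 (W ++ X) -> u \in tW ++ tX ->
        ribbon_colored (z, p) u.
      by move=> zn ut; rewrite ribbon_colored_sym newl.
    have new3 u : u \in tW ++ tX ->
        all (ribbon_colored u) [:: (b, (c, e)); (a, (e, e)); (b, (e, c))].
      by move=> ut; rewrite /= !newl.
    have inW u : u \in tW -> u \in tW ++ tX by rewrite mem_cat => ->.
    have inX u : u \in tX -> u \in tW ++ tX by rewrite mem_cat => ->; rewrite orbT.
    move: rib; rewrite !pairwise_cat => /and3P[ribWX ribW ribX].
    set t3 := [:: (b, _); _; _] in new3 *.
    have rib3 : pairwise ribbon_colored ((a, (e, e)) :: t3).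
      by rewrite /= /ribbon_colored /= !eqxx [b.1 == _]eq_sym (negbTE neq_ab).
    move: rib3; rewrite pairwise_cons => /andP[riba rib3].
    rewrite pairwise_cons pairwise_cat ribW ribX rib3 all_cat riba !andbT /=.
    apply/and3P; split.
    * apply/allrelP => u v uW; rewrite inE mem_cat => /or3P[/eqP ->|vX|v3].
      - by apply: newl => //; apply: inW.
      - exact: (allrelP ribWX).
      - exact: (allP (new3 u (inW u uW))).
    * by apply/allP => u uX; apply: newr => //; apply: inX.
    * by apply/allrelP => u v uX; apply/allP/new3/inX.
- case/map_eq_cat=> tW [[|ta t1] [-> tWE //=]] [taE].
  case/map_eq_cat=> tX [t2 [-> tXE]].
  case: t2 => [|tb [|ta' [|tb' [|? ?]]]] //= [tbE ta'E tb'E].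
  move=> /chain_cat[e chW] /= /andP[/eqP e1] /chain_cat[l chX] /=.
  move=> /and4P[/eqP e2 /eqP e3 /eqP e4 /eqP e5] rib.
  (* Restricting to the two ends of [a], then to those of [b], gives the ribbon equations [e6] to
     [e9]. *)
  have : pairwise ribbon_colored [:: ta; ta'].
    apply: subseq_pairwise rib; apply: (cat_subseq (sub0seq tW)).
    apply: (cat_subseq (subseq_refl [:: ta])); apply: (cat_subseq (sub0seq tX)).
    exact: (cat_subseq (sub0seq [:: tb]) (prefix_subseq [:: ta'] [:: tb'])).
  have : pairwise ribbon_colored [:: tb; tb'].
    apply: subseq_pairwise rib; apply: (cat_subseq (sub0seq tW)).
    apply: subseq_trans (subseq_cons _ _); apply: (cat_subseq (sub0seq tX)).
    exact: (cat_subseq (subseq_refl [:: tb]) (suffix_subseq [:: ta'] [:: tb'])).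
  rewrite /= !andbT /ribbon_colored taE ta'E tbE tb'E !eqxx /=.
  move=> /andP[/eqP e6 /eqP e7] /andP[/eqP e8 /eqP e9].
  have ribWX : pairwise ribbon_colored (tW ++ tX).
    apply: subseq_pairwise rib; rewrite subseq_cat2l.
    by apply: subseq_trans (subseq_cons _ _); apply: prefix_subseq.
  (* The stop of the first [a] returns to [e] and the start of the first [b] is [c], so deleting the
     new ends leaves a closed chain through [W] and [X]. *)
  have ke : ta.2.2 = e by congruence.
  have lc : l = c by congruence.
  rewrite ke lc in chX.
  have := good (tW ++ tX) c; rewrite /unzip1 map_cat tWE tXE.
  move=> /(_ erefl (cat_chain chW chX) ribWX).
  rewrite /monochromatic !all_cat /= all_cat => /andP[mW mX].
  have ec := chain_monochromatic chW mW; rewrite mW mX /= andbT.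
  by rewrite -!pair_eqE /= /pair_eq; apply/and4P; split;
     apply/andP; split; apply/eqP; congruence.
Qed.

(** * Quasi-trees of the twisted Fibonacci bouquet *)

(** The rotation on [m.+1] edges without its last letter. Unlike full rotations, these words are
    prefixes of one another, which permits induction from the right end. *)
Definition F1_prefix (m : nat) : seq letter :=
  (1, true) :: [seq (j, false) | j <- flatten [seq [:: i; i.-1] | i <- iota 2 m]].

Lemma F1_rotationE m : F1_rotation m.+1 = F1_prefix m ++ [:: (m.+1, false)].
Proof. by rewrite /F1_rotation /F1_prefix /F_word /= map_cat. Qed.

Lemma F1_prefixS m :
  F1_prefix m.+1 = F1_prefix m ++ [:: (m.+2, false); (m.+1, false)].
Proof.
rewrite {1}/F1_prefix.
have -> : iota 2 m.+1 = iota 2 m ++ [:: m.+2] by rewrite -cat1s -(iotaD 2 m 1) addn1.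
by rewrite map_cat flatten_cat map_cat.
Qed.

Lemma F1_prefix_le m x : x \in unzip1 (F1_prefix m) -> x <= m.+1.
Proof.
elim: m => [|m IH]; first by rewrite inE => /eqP ->.
rewrite F1_prefixS /unzip1 map_cat mem_cat => /orP[/IH|]; first lia.
by rewrite !inE => /orP[] /eqP -> /=.
Qed.

(* For [F] included in [1 .. n]: every maximal run of consecutive elements of
   [F] that does not contain [1] has even length. *)
Fixpoint even_runs (n : nat) (F : {fset nat}) : bool :=
  match n with
  | 0 | 1 => true
  | (m.+1 as m1).+1 =>
      if n \in F then (m1 \in F) && even_runs m F else even_runs m1 F
  end.

(** Strong induction on the top edge: if absent, it is dropped; if present without its predecessor,
    its ends form a kink; if both are present, the pair is removed as a handle. *)
Lemma colorings_constant_F1 (n : nat) (F : {fset nat}) :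
  colorings_constant [seq x <- F1_rotation n.+1 | x.1 \in F] <-> even_runs n.+1 F.
Proof.
have fresh (s : seq letter) i m :
    (forall x, x \in unzip1 s -> x <= m) -> m < i ->
    i \notin unzip1 [seq x <- s | x.1 \in F].
  move=> H lt_mi; apply/negP => /mapP[x]; rewrite mem_filter => /andP[_ xs] ix.
  by have := H i; rewrite ix map_f // -ix leqNgt lt_mi => /(_ isT).
elim/ltn_ind: n => -[_|m IH].
  (* Edge [1] alone gives a Möbius band, with one boundary circle; without it the word is empty. *)
  split=> // _; rewrite /F1_rotation /=; case: ifP => ->; last by move=> [|u t] c.
  case=> [//|[[? ?] [c1 d1]] [//|[[? ?] [c2 d2]] [|//]]] c [-> -> -> ->] /=.
  case/and3P=> /eqP -> /eqP -> /eqP ->; rewrite /ribbon_colored /=.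
  by case: c d1 => [] [].
rewrite F1_rotationE F1_prefixS -catA filter_cat [X in _ ++ X]/=.
rewrite [even_runs _ _]/=.
case F2: (m.+2 \in F); last first.
  by rewrite -IH // F1_rotationE filter_cat.
case F1: (m.+1 \in F); last first.
  split=> // good; case: (colorings_constant_kink _ good).
  by apply: (fresh _ _ m.+1) => // x /F1_prefix_le.
(* On edges [1] and [2] the word is [(-1,2,1,2)]; the half-twist of [1] rules out the handle
   reduction, so the colours are enumerated. *)
case: m IH F1 F2 => [|m] IH F1 F2.
  split=> // _; rewrite /F1_prefix /= F1.
  case=> [//|[[? ?] [c1 d1]] [//|[[? ?] [c2 d2]] [//|[[? ?] [c3 d3]] [//|[[? ?] [c4 d4]] [|//]]]]] c.
  move=> [-> -> -> -> -> -> -> ->] /=.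
  case/and5P=> /eqP -> /eqP -> /eqP -> /eqP -> /eqP ->; rewrite /ribbon_colored /=.
  by case: c d1 d2 d3 => [] [] [] [].
(* The handle has [a = m.+2] and [b = m.+3]; [X] is the last end of [m.+1], or empty if [m.+1] is
   not in [F]. *)
rewrite andTb -IH // F1_prefixS F1_rotationE !filter_cat -catA.
rewrite [[seq x <- [:: (m.+2, _); _] | _]]/= F1.
have new i : m.+1 < i ->
    i \notin unzip1 ([seq x <- F1_prefix m | x.1 \in F] ++
                     [seq x <- [:: (m.+1, false)] | x.1 \in F]).
  move=> lt_i; rewrite /unzip1 map_cat mem_cat negb_or; apply/andP; split.
    by apply: (fresh _ _ m.+1) => // x /F1_prefix_le.
  by rewrite /=; case: ifP => // _; rewrite inE /=; lia.
by apply: colorings_constant_handle; rewrite /= ?new //; lia.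
Qed.

(** * Counting the sets with even runs *)

Local Open Scope fset_scope.

Lemma even_runsSS (m : nat) (F : {fset nat}) :
  even_runs m.+2 F =
  if m.+2 \in F then (m.+1 \in F) && even_runs m F else even_runs m.+1 F.
Proof. by []. Qed.

Lemma eq_even_runs (n : nat) (F G : {fset nat}) :
  (forall i, i <= n -> (i \in F) = (i \in G)) -> even_runs n F = even_runs n G.
Proof.
elim/ltn_ind: n => -[//|[//|m]] IH FG; rewrite !even_runsSS !FG //.
by rewrite !(IH _ _ (fun i le_im => FG i _)) //; lia.
Qed.

Definition even_run_sets (n : nat) : {fset {fset nat}} :=
  [fset F in fpowerset [fset i in iota 1 n] | even_runs n F].

Lemma in_even_run_sets (n : nat) (F : {fset nat}) :
  reflect ((forall i, i \in F -> 0 < i <= n) /\ even_runs n F)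
          (F \in even_run_sets n).
Proof.
rewrite !inE /= fpowersetE; apply: (iffP andP) => -[sub ->]; split=> //.
  by move=> i /(fsubsetP sub); rewrite !inE /= mem_iota; lia.
by apply/fsubsetP => i /sub; rewrite !inE /= mem_iota; lia.
Qed.

Definition add_top (m : nat) (F : {fset nat}) : {fset nat} :=
  m.+2 |` (m.+1 |` F).

(** [m.+2] can only occur together with [m.+1], and deleting both leaves a set counted at [m]. *)
Lemma even_run_setsSS (m : nat) :
  even_run_sets m.+2 =
  even_run_sets m.+1 `|` [fset add_top m F | F in even_run_sets m].
Proof.
apply/fsetP => F; rewrite in_fsetU; apply/in_even_run_sets/orP.
- rewrite even_runsSS => -[subF]; case: ifP => F2.
  + case/andP=> F1 evF; right; apply/imfsetP.
    exists (F `\` [fset m.+1; m.+2]) => /=.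
      apply/in_even_run_sets; split.
        by move=> i; rewrite !inE negb_or => /andP[/andP[? ?] /subF]; lia.
      rewrite -(eq_even_runs _ (F := F)) // => i le_im; rewrite !inE.
      by have [-> ->] : (i == m.+1) = false /\ (i == m.+2) = false by lia.
    apply/fsetP => i; rewrite !inE.
    by case: eqP => [->|_] //=; case: eqP => [->|_].
  + move=> evF; left; apply/in_even_run_sets; split=> // i iF.
    have := subF i iF; have : i != m.+2 by apply: contraFneq F2 => <-.
    lia.
- case=> [/in_even_run_sets[subF evF] | /imfsetP[G /= /in_even_run_sets[subG evG] ->]].
  + split=> [i /subF|]; first lia.
    have /negbTE F2 : m.+2 \notin F by apply/negP => /subF; lia.
    by rewrite even_runsSS F2.
  + split=> [i|]; first by rewrite !inE => /or3P[/eqP ->|/eqP ->|/subG]; lia.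
    rewrite !inE !eqxx orbT /= -(eq_even_runs _ (F := G)) // => i le_im.
    by rewrite !inE; have [-> ->] : (i == m.+2) = false /\ (i == m.+1) = false by lia.
Qed.

(** The union is disjoint, as only its second part uses [m.+2], and [add_top] is injective on sets
    bounded by [m]. This is the Fibonacci recursion, with values 1 and 2 at [n = 0] and [n = 1]. *)
Lemma card_even_run_sets (n : nat) : #|` even_run_sets n| = fib (n + 2).
Proof.
rewrite addn2; elim/ltn_ind: n => -[_|[_|m IH]].
- have -> : even_run_sets 0 = [fset fset0]; last by rewrite cardfs1.
  apply/fsetP => F; rewrite in_fset1; apply/in_even_run_sets/eqP => [[subF _]|->].
    by apply/fsetP => i; rewrite inE; apply/negP => /subF; lia.
  by split=> // i; rewrite inE.
- have -> : even_run_sets 1 = [fset fset0; [fset 1]].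
    have E : [fset i in iota 1 1] = [fset 1].
      by apply/fsetP => i; rewrite !inE /= orbF.
    by apply/fsetP => F; rewrite !inE E fpowerset1 !inE andbT.
  by rewrite cardfs2; case: eqP => // /fsetP/(_ 1); rewrite !inE.
rewrite even_run_setsSS cardfsU.
have -> : even_run_sets m.+1 `&` [fset add_top m F | F in even_run_sets m] = fset0.
  apply/fsetP => F; rewrite in_fsetI in_fset0; apply/negP => /andP[].
  move=> /in_even_run_sets[subF _] /imfsetP[G /= _ FE].
  by have := subF m.+2; rewrite FE !inE eqxx => /(_ isT); lia.
have inj : {in even_run_sets m &, injective (add_top m)}.
  move=> F G /in_even_run_sets[subF _] /in_even_run_sets[subG _] /fsetP FG.
  apply/fsetP => i; have := FG i; rewrite !inE.
  case: eqP => [-> _|_]; last case: eqP => [-> _|//].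
    by apply/idP/idP => [/subF|/subG]; lia.
  by apply/idP/idP => [/subF|/subG]; lia.
rewrite cardfs0 subn0 (eqP (introT (card_in_imfsetP _ _) inj)).
by rewrite !IH.
Qed.

Theorem theorem5p3 (n : nat) (n_gt0 : 0 < n) :
  kappa (bouquetF1 n_gt0) = fib (n + 2).
Proof.
rewrite -card_even_run_sets /kappa; congr #|` _|.
(* The word is a permutation of two copies of [1 .. n], which fixes the set of labels. *)
have edgesE : edges (bouquetF1 n_gt0) = [fset i in iota 1 n].
  have wordE : unzip1 (F1_rotation n) = F_word n.
    by rewrite /F1_rotation /= /unzip1 -map_comp map_id.
  rewrite /edges [rotation _]/= wordE; apply/fsetP => i.
  by apply/imfsetP/imfsetP => -[j /= jE ->]; exists j => //=;
     move: jE; rewrite (perm_mem (F_word_perm n_gt0)) mem_cat orbb.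
apply/fsetP => F; rewrite !inE edgesE; congr (_ && _).
case: n n_gt0 {edgesE} => // m m_gt0; rewrite /quasi_tree /=.
by apply/idP/idP => [/n_boundary1P/colorings_constant_F1|
                     /colorings_constant_F1/n_boundary1P].
Qed.
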